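(* For any integer $n\geq 2$, $$b_t(G_{n,2})=\begin{cases}1 & \text{if } n\equiv 0 \pmod 3,\\ 2 & \text{if } n\equiv 2 \pmod 3,\\ 3 & \text{if } n\equiv 1 \pmod 3.\end{cases}$$
   Context: All graphs are finite, undirected, without loops or multiple edges. For positive integers $n,m$, the $(n,m)$-grid graph $G_{n,m}=P_n\times P_m$ is the Cartesian product of the paths $P_n$ and $P_m$: its vertex set is $\{x_{ij} : 1\le i\le n,\ 1\le j\le m\}$, and $x_{ij}$ and $x_{i'j'}$ are adjacent if and only if either $i=i'$ and $|j-j'|=1$, or $j=j'$ and $|i-i'|=1$. For a graph $G$ without isolated vertices, a total dominating set of $G$ is a set $D\subseteq V(G)$ such that every vertex of $G$ (including those in $D$) has at least one neighbor in $D$. The total domination number $\gamma_t(G)$ is the minimum cardinality of a total dominating set of $G$. The total bondage number $b_t(G)$ of a graph $G$ without isolated vertices is the minimum cardinality of a set $B\subseteq E(G)$ of edges such that the graph $G-B$ obtained by removing the edges in $B$ (keeping all vertices) has no isolated vertices and satisfies $\gamma_t(G-B)>\gamma_t(G)$; if no such $B$ exists, $b_t(G)=\infty$. *)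

(* Defs.v *)
From mathcomp Require Import all_boot ssrint.

Set Implicit Arguments.
Unset Strict Implicit.
Unset Printing Implicit Defensive.

Record sgraph := SGraph {
  vertex :> finType;
  adj : rel vertex;
  adj_sym : symmetric adj;
  adj_irrefl : irreflexive adj
}.

(* An edge is encoded as the set of its two endpoints. *)
Definition edges (G : sgraph) : {set {set G}} :=
  [set e | [exists x : G, exists y : G, adj x y && (e == [set x; y])]].

Section DeleteEdges.
Variables (G : sgraph) (B : {set {set G}}).

Definition del_adj : rel G := fun x y => adj x y && ([set x; y] \notin B).

Lemma del_adj_sym : symmetric del_adj.
Proof. by move=> x y; rewrite /del_adj adj_sym setUC. Qed.

Lemma del_adj_irrefl : irreflexive del_adj.
Proof. by move=> x; rewrite /del_adj adj_irrefl. Qed.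

Definition del_edges : sgraph := SGraph del_adj_sym del_adj_irrefl.

End DeleteEdges.

Definition no_isolated (G : sgraph) : bool :=
  [forall x : G, exists y : G, adj x y].

Definition total_dominating (G : sgraph) (D : {set G}) : bool :=
  [forall x : G, exists y in D, adj x y].

(* When G has no isolated vertices, [set: G] is a total dominating set, so the
   arg min is attained; otherwise there is no total dominating set and the
   value #|G| is a dummy. *)
Definition total_domination_number (G : sgraph) : nat :=
  #|[arg min_(D < [set: G] | total_dominating D) #|D|]|.

Definition total_bonding (G : sgraph) (B : {set {set G}}) : bool :=
  [&& B \subset edges G, no_isolated (del_edges B)
    & total_domination_number G < total_domination_number (del_edges B)].

(* None stands for infinity. *)
Definition total_bondage_number (G : sgraph) : option nat :=
  if [pick B : {set {set G}} | total_bonding B] is Some B0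
  then Some #|[arg min_(B < B0 | total_bonding B) #|B|]|
  else None.

Section Grid.
Variables n m : nat.

(* The vertex x_{ij} is (i, j), with indices starting at 0. *)
Definition grid_adj : rel ('I_n * 'I_m) := fun x y =>
  ((x.1 == y.1) && (`|x.2 - y.2|%N == 1)) ||
  ((x.2 == y.2) && (`|x.1 - y.1|%N == 1)).

Lemma grid_adj_sym : symmetric grid_adj.
Proof.
move=> x y; rewrite /grid_adj [y.1 == _]eq_sym [y.2 == _]eq_sym.
by rewrite (distnC y.2) (distnC y.1).
Qed.

Lemma grid_adj_irrefl : irreflexive grid_adj.
Proof. by move=> x; rewrite /grid_adj !distnn !andbF. Qed.

Definition grid : sgraph := SGraph grid_adj_sym grid_adj_irrefl.

End Grid.

(* Main.v *)
Require Import Defs.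
From mathcomp Require Import all_boot.
From mathcomp Require Import zify.

Set Implicit Arguments.
Unset Strict Implicit.
Unset Printing Implicit Defensive.

(** Color the vertex in column i and row a of the ladder by the parity of i + a.
    Each column has one vertex of each color, and two vertices are adjacent
    exactly when their colors differ and their columns differ by at most 1
    [adj_ladder].  Hence the vertices of one color, used to dominate those of
    the other, behave as columns dominating columns at distance at most 1, and
    total domination of the ladder splits into two independent copies of the
    domination of a path with n vertices.  Each copy costs ceil(n/3), which is
    written (n + 2) %/ 3, so the total domination number is twice that.  Deleting
    an edge removes from each copy one ordered pair (dominator, dominated).

    Lower bounds.  In a copy, the dominators in the columns congruent to r modulo
    3 have disjoint neighborhoods and can miss only the first column (when r = 2)
    and the last one (when n = r modulo 3).  Since no vertex is isolated, any
    neighbor of a missed vertex completes the set.  The completed set has size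
    ceil(n/3) for r = 1 when n = 0, for r = 0, 1 when n = 2, and for r = 0, 1, 2
    when n = 1 modulo 3.  An edge has a single end of the dominating color, so it
    spoils at most one residue r: with fewer deletions than there are such
    residues, one of them survives in each copy and the total domination number
    does not increase [total_bonding_ge].

    Upper bounds.  Vertices with pairwise disjoint neighborhoods bound the total
    domination number from below.  In one copy the columns 0, 3, 6, ... form such
    a packing of size ceil(n/3).  In the other copy the columns congruent to n - 1
    modulo 3 form another one, and one, two or three well-chosen deletions at the
    left end make room for one more vertex [total_bonding_deleted]. *)

(** * Total domination and packings *)

Lemma card_le_size (T : finType) (U : eqType) (f : T -> U) (A : {set T})
    (s : seq U) :
  {in A &, injective f} -> {in A, forall x, f x \in s} -> #|A| <= size s.
Proof.
move=> injf fAs; rewrite cardE -(size_map f).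
apply: uniq_leq_size.
  by rewrite map_inj_in_uniq ?enum_uniq // => x y; rewrite !mem_enum; apply: injf.
by move=> _ /mapP[x + ->]; rewrite mem_enum; apply: fAs.
Qed.

Section TotalDomination.
Variable G : sgraph.
Implicit Types D P : {set G}.

(** Two vertices of the set with a common neighbor are equal: their open
    neighborhoods are pairwise disjoint. *)
Definition packing P :=
  forall x z y : G, x \in P -> z \in P -> adj x y -> adj z y -> x = z.

Lemma no_isolatedP :
  reflect (forall x : G, exists y, adj x y) (no_isolated G).
Proof.
by apply: (iffP forallP) => GG x; [case/existsP: (GG x) => y; exists y
  | apply/existsP; apply: GG].
Qed.

Lemma total_dominatingP D :
  reflect (forall x : G, exists2 y, y \in D & adj x y) (total_dominating D).
Proof.
apply: (iffP forallP) => domD x.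
  by have /existsP[y /andP[]] := domD x; exists y.
by have [y Dy xy] := domD x; apply/existsP; exists y; rewrite Dy.
Qed.

Lemma total_dominating_setT : no_isolated G -> total_dominating [set: G].
Proof.
move=> /no_isolatedP noiso; apply/total_dominatingP => x.
by have [y xy] := noiso x; exists y.
Qed.

Lemma total_domination_number_le D :
  total_dominating D -> total_domination_number G <= #|D|.
Proof.
move=> domD; rewrite /total_domination_number; case: arg_minnP => [|D0 _]; last exact.
apply/total_dominatingP => x; have /total_dominatingP/(_ x)[y _ xy] := domD.
by exists y.
Qed.

(** Choosing for each vertex of P a dominator in D is injective on P, since the
    chosen neighbors lie in disjoint neighborhoods. *)
Lemma leq_packing_dominating P D :
  packing P -> total_dominating D -> #|P| <= #|D|.
Proof.
move=> packP /total_dominatingP domD.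
pose f x := odflt x [pick y in D | adj x y].
have fP x : (f x \in D) && adj x (f x).
  rewrite /f; case: pickP => [y|no] //=.
  by have [y Dy xy] := domD x; have := no y; rewrite Dy xy.
rewrite [#|D|]cardE; apply: (card_le_size (f := f)) => [x z Px Pz eqf | x _].
  apply: packP (f x) Px Pz _ _; first by case/andP: (fP x).
  by rewrite eqf; case/andP: (fP z).
by rewrite mem_enum; case/andP: (fP x).
Qed.

Lemma leq_packing_total_domination_number P :
  no_isolated G -> packing P -> #|P| <= total_domination_number G.
Proof.
move=> /total_dominating_setT domT packP.
rewrite /total_domination_number; case: arg_minnP => // D domD _.
exact: leq_packing_dominating.
Qed.

End TotalDomination.

Section Deletion.
Variable G : sgraph.
Implicit Type B : {set {set G}}.

Lemma total_domination_number_del B : no_isolated (del_edges B) ->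
  total_domination_number G <= total_domination_number (del_edges B).
Proof.
move=> /total_dominating_setT domT.
rewrite [leqRHS]/total_domination_number; case: arg_minnP => // D domD _.
apply: total_domination_number_le; apply/total_dominatingP => x.
by have /total_dominatingP/(_ x)[y Dy /andP[xy _]] := domD; exists y.
Qed.

(** It is enough to bound #|B| from above: the last hypothesis applied to B
    supplies the opposite inequality. *)
Lemma total_bondage_number_eq B t :
    total_bonding B -> #|B| <= t ->
    (forall B', total_bonding B' -> t <= #|B'|) ->
  total_bondage_number G = Some t.
Proof.
move=> bondB leBt minB; rewrite /total_bondage_number.
case: pickP => [B0 bondB0 | /(_ B)]; last by rewrite bondB.
case: arg_minnP => // B1 bondB1 /(_ B bondB) leB1B.
by congr Some; apply/eqP; rewrite eqn_leq (leq_trans leB1B leBt) minB.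
Qed.

End Deletion.

(** * The ladder as two paths *)

Definition near (i j : nat) := (i <= j.+1) && (j <= i.+1).

Section Ladder.
Variable n : nat.
Implicit Types (x y z : grid n 2) (c : bool) (B : {set {set grid n 2}}).

Definition color x : bool := odd (x.1 + x.2).

Definition cell c (i : 'I_n) : grid n 2 := (i, inord (c (+) odd i)).

Lemma color_cell c i : color (cell c i) = c.
Proof. by rewrite /color /= inordK ?oddD; case: c (odd i) => [] []. Qed.

Lemma cell_color x : cell (color x) x.1 = x.
Proof.
case: x => i [[|[|//]] a_lt]; rewrite /cell /color /=; congr (_, _); apply: val_inj;
  by rewrite /= inordK oddD; case: (odd i).
Qed.

Lemma cell_inj c : injective (cell c).
Proof. by move=> i j []. Qed.

Lemma eq_from_column_color x y : x.1 = y.1 -> color x = color y -> x = y.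
Proof. by move=> e1 ec; rewrite -(cell_color x) -(cell_color y) e1 ec. Qed.

(** A rung keeps the column and changes the row; a rail does the opposite and
    moves by one column.  Both change the parity of the sum of the coordinates,
    and conversely the color determines the row once the column is known. *)
Lemma adj_ladder x y : adj x y = (color x != color y) && near x.1 y.1.
Proof.
rewrite /near /color /= /grid_adj -!(inj_eq val_inj).
case: x y => [[i i_lt] [[|[|//]] a_lt]] [[j j_lt] [[|[|//]] b_lt]] /=; lia.
Qed.

Definition class c (r : nat) : {set grid n 2} :=
  [set x | (color x == c) && (x.1 %% 3 == r)].

Lemma card_class c r : r < 3 -> #|class c r| = (n + 2 - r) %/ 3.
Proof.
move=> r_lt3; have ->: class c r = cell c @: [set i : 'I_n | i %% 3 == r].
  apply/setP=> x; rewrite inE; apply/andP/imsetP => [[/eqP <- xr] | [i + ->]].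
    by exists x.1; rewrite ?inE // cell_color.
  by rewrite inE color_cell.
rewrite card_imset; last exact: cell_inj.
rewrite -sum1dep_card big_mkcond /=.
elim: n => [|m IHm]; first by rewrite big_ord0; lia.
by rewrite big_ord_recr /= IHm; case: eqP; lia.
Qed.

(** Columns in the same residue class are equal or at distance at least 3, while
    two neighbors of the same vertex are at most two columns apart. *)
Lemma packing_class c r : packing (class c r).
Proof.
move=> x z y; rewrite !inE => /andP[/eqP xc /eqP xr] /andP[/eqP zc /eqP zr].
rewrite !adj_ladder /near => /andP[_ xy] /andP[_ zy].
by apply: eq_from_column_color; [apply: ord_inj; lia | rewrite xc].
Qed.

Lemma no_isolated_ladder : no_isolated (grid n 2).
Proof.
apply/no_isolatedP => x; exists (cell (~~ color x) x.1).
by rewrite adj_ladder color_cell /near /= !leqnSn; case: (color x).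
Qed.

Lemma color_adj x y : adj x y -> color x = ~~ color y.
Proof. by rewrite adj_ladder; case: (color x) (color y) => [] []. Qed.

Lemma card_setU_colors c (P Q : {set grid n 2}) :
    {in P, forall x, color x = c} -> {in Q, forall x, color x = ~~ c} ->
  #|P :|: Q| = #|P| + #|Q|.
Proof.
move=> Pc Qc; apply/eqP; rewrite (leq_card_setU P Q) -setI_eq0.
apply/eqP/setP=> x; rewrite !inE.
by apply/andP => -[/Pc xc /Qc]; rewrite xc; case: (c).
Qed.

(** Neighbors of a vertex share a color, so vertices of different colors never
    compete for a neighbor. *)
Lemma packing_colors B c (P Q : {set del_edges B}) :
    {in P, forall x, color x = c} -> {in Q, forall x, color x = ~~ c} ->
    packing P -> packing Q ->
  packing (P :|: Q).
Proof.
move=> Pc Qc packP packQ x z y PQx PQz xy zy.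
have opp u : adj u y -> color u = ~~ color y by case/andP=> /color_adj.
have xz : color x = color z by rewrite (opp x) ?(opp z).
case/setUP: PQx => [Px|Qx]; case/setUP: PQz => [Pz|Qz].
- exact: packP xy zy.
- by move: xz; rewrite Pc ?Qc //; case: (c).
- by move: xz; rewrite Qc ?Pc //; case: (c).
- exact: packQ xy zy.
Qed.

(** * Few deletions do not matter *)

(** The columns 0, 3, 6, ... give in each color a packing of size ceil(n/3). *)
Lemma total_domination_number_ladder_ge :
  ((n + 2) %/ 3).*2 <= total_domination_number (grid n 2).
Proof.
have pack : packing (class false 0 :|: class true 0).
  move=> x z y xP zP xy zy.
  have xz : color x = color z by rewrite (color_adj xy) (color_adj zy).
  apply: (@packing_class (color x) 0 x z y _ _ xy zy).
    by move: xP; rewrite !inE; case: (color x); rewrite /= ?orbF.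
  by rewrite xz; move: zP; rewrite !inE; case: (color z); rewrite /= ?orbF.
have := leq_packing_total_domination_number no_isolated_ladder pack.
rewrite (@card_setU_colors false); first by rewrite !card_class // subn0 addnn.
  by move=> x; rewrite inE => /andP[/eqP].
by move=> x; rewrite inE => /andP[/eqP].
Qed.

(** For n > 0 and r < 3, the columns at distance at least 2 from every column of
    residue r.  Such a column is at an end of the ladder, because any three
    consecutive columns realize all residues. *)
Definition missed_columns (r : nat) : seq nat :=
  (if r == 2 then [:: 0] else [::]) ++ (if n %% 3 == r then [:: n.-1] else [::]).

Lemma near_class r i : r < 3 -> i < n -> i \notin missed_columns r ->
  exists2 j, j < n & (j %% 3 == r) && near i j.
Proof.
move=> r_lt3 i_ltn missed.
have: [|| i %% 3 == r, i %% 3 == r.+1 %% 3 | i.+1 %% 3 == r] by lia.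
rewrite /near; case/or3P => ir; [exists i | exists i.-1 | exists i.+1]; try lia.
- by move: missed; rewrite mem_cat negb_or => /andP[+ _]; case: (r =P 2); rewrite ?inE; lia.
- by move: missed; rewrite mem_cat negb_or => /andP[_]; case: (n %% 3 =P r); rewrite ?inE; lia.
Qed.

(** No deleted edge has its end of color c in a column of residue r, so the
    vertices of [class c r] keep all their neighbors. *)
Definition intact B c r := forall x y,
  color x = c -> x.1 %% 3 = r -> adj x y -> [set x; y] \notin B.

(** For an edge, the pick is unambiguous: exactly one end has color c. *)
Definition residue c (e : {set grid n 2}) : nat :=
  if [pick x in e | color x == c] is Some x then x.1 %% 3 else 0.

Lemma residue_edge c x y :
  color x = c -> color y != c -> residue c [set x; y] = x.1 %% 3.
Proof.
move=> xc yc; rewrite /residue; case: pickP => [z | /(_ x)].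
  by rewrite !inE => /andP[/orP[]/eqP-> // yc']; rewrite yc' in yc.
by rewrite !inE xc !eqxx.
Qed.

(** Pigeonhole: each deleted edge spoils only the residue of its end of
    color c. *)
Lemma has_intact_class B c (rs : seq nat) :
  uniq rs -> #|B| < size rs -> exists2 r, r \in rs & intact B c r.
Proof.
move=> uniq_rs ltBrs; pose hit := [seq residue c e | e <- enum B].
have /allPn[r rs_r hit_r] : ~~ all (mem hit) rs.
  apply/negP=> /allP rs_hit; have := uniq_leq_size uniq_rs rs_hit.
  by rewrite size_map -cardE leqNgt ltBrs.
exists r => // x y xc xr; rewrite adj_ladder => /andP[xy _].
apply: contra hit_r => Bxy; apply/mapP; exists [set x; y]; first by rewrite mem_enum.
by rewrite residue_edge // -?xc // eq_sym.
Qed.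

(** The dominating set consists of the intact class, completed by one neighbor of
    each vertex that the class misses; that neighbor exists in the graph after
    deletion because there is no isolated vertex. *)
Lemma intact_class_dominates B c r :
    r < 3 -> no_isolated (del_edges B) -> intact B c r ->
  exists2 D : {set del_edges B},
    #|D| <= (n + 2 - r) %/ 3 + size (missed_columns r) &
    forall x : del_edges B, color x = ~~ c -> exists2 y, y \in D & adj x y.
Proof.
move=> r_lt3 /no_isolatedP/fin_all_exists[nb nbP] intact_r.
pose missed := [set x : grid n 2 | (color x == ~~ c) && (val x.1 \in missed_columns r)].
exists (class c r :|: nb @: missed).
  rewrite (leq_trans (leq_card_setU _ _)) // card_class // leq_add2l.
  apply: leq_trans (leq_imset_card _ _) _.
  apply: (card_le_size (f := fun x : grid n 2 => val x.1)) => [x y | x]; rewrite !inE.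
    move=> /andP[/eqP xc _] /andP[/eqP yc _] /val_inj xy.
    by apply: eq_from_column_color; rewrite ?xc.
  by case/andP.
move=> x xc; have [missx | ] := boolP (val x.1 \in missed_columns r).
  by exists (nb x) => //; apply/setUP; right; apply: imset_f; rewrite inE xc eqxx.
case/(near_class r_lt3 (ltn_ord _)) => j j_ltn /andP[jr xj].
pose y := cell c (Ordinal j_ltn); have yc : color y = c := color_cell c _.
have xy : @adj (grid n 2) x y by rewrite adj_ladder xc yc xj; case: (c).
exists y; first by rewrite !inE yc eqxx jr.
apply/andP; split=> //; rewrite setUC; apply: intact_r => //; first exact/eqP.
by rewrite adj_sym.
Qed.

(** The completed class is no larger than ceil(n/3), the least size possible even
    without deletions. *)
Definition optimal_class (r : nat) :=
  (r < 3) && ((n + 2 - r) %/ 3 + size (missed_columns r) <= (n + 2) %/ 3).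

(** The intact residue may differ between the two colors; the two halves are
    chosen independently. *)
Lemma total_domination_number_few_deletions B (rs : seq nat) :
    no_isolated (del_edges B) -> uniq rs -> #|B| < size rs ->
    all optimal_class rs ->
  total_domination_number (del_edges B) <= ((n + 2) %/ 3).*2.
Proof.
move=> noiso uniq_rs ltBrs rsP.
have half c : exists2 D : {set del_edges B}, #|D| <= (n + 2) %/ 3 &
    forall x : del_edges B, color x = ~~ c -> exists2 y, y \in D & adj x y.
  have [r /(allP rsP)/andP[r_lt3 leD] intact_r] := has_intact_class c uniq_rs ltBrs.
  have [D leD' domD] := intact_class_dominates r_lt3 noiso intact_r.
  by exists D => //; apply: leq_trans leD' leD.
have [D0 leD0 domD0] := half false; have [D1 leD1 domD1] := half true.
apply: (@leq_trans #|D0 :|: D1|); last first.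
  by rewrite (leq_trans (leq_card_setU _ _)) // -addnn leq_add.
apply/total_domination_number_le/total_dominatingP => x.
have [/domD0|/domD1] : color x = ~~ false \/ color x = ~~ true.
- by case: (color x); [left|right].
- by case=> y Dy xy; exists y => //; rewrite inE Dy.
- by case=> y Dy xy; exists y => //; rewrite inE Dy orbT.
Qed.

(** Residue 1 is optimal for every n. *)
Lemma total_domination_number_ladder_le :
  total_domination_number (grid n 2) <= ((n + 2) %/ 3).*2.
Proof.
have noiso : no_isolated (del_edges (set0 : {set {set grid n 2}})).
  apply/no_isolatedP => x; have [y xy] := no_isolatedP _ no_isolated_ladder x.
  by exists y; rewrite /= /del_adj inE andbT.
apply: leq_trans (total_domination_number_del noiso) _.
apply: (total_domination_number_few_deletions (rs := [:: 1])) => //.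
  by rewrite cards0.
by rewrite /optimal_class /missed_columns /=; case: eqP => /=; lia.
Qed.

(** A total domination number that stays at most 2 ceil(n/3), the value for the
    whole ladder, has not increased. *)
Lemma total_bonding_ge B (rs : seq nat) :
    uniq rs -> all optimal_class rs ->
  total_bonding B -> size rs <= #|B|.
Proof.
move=> uniq_rs rsP /and3P[_ noiso]; rewrite [size rs <= _]leqNgt.
apply: contraL => ltBrs; rewrite -leqNgt.
apply: leq_trans total_domination_number_ladder_ge.
exact: total_domination_number_few_deletions ltBrs rsP.
Qed.

(** * Small bonding sets *)

(** An edge is given by the columns of its end of color [false] and of its end of
    color [true], in this order, which makes the encoding injective. *)
Definition ladder_edge (p : 'I_n * 'I_n) : {set grid n 2} :=
  [set cell false p.1; cell true p.2].

Lemma ladder_edge_inj : injective ladder_edge.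
Proof.
move=> [i j] [k l] /setP eqe; have cellE c u v : (cell c u == cell (~~ c) v) = false.
  by apply/eqP=> /(congr1 color); rewrite !color_cell; case: c.
move: (eqe (cell false i)) (eqe (cell true j)); rewrite !inE /= !eqxx !orbT /=.
rewrite (cellE false) (cellE true) orbF /= => /esym/eqP/cell_inj-> /esym/eqP/cell_inj->.
by [].
Qed.

Variable s : seq (nat * nat).

Definition deleted : {set {set grid n 2}} :=
  [set ladder_edge p | p : 'I_n * 'I_n & (val p.1, val p.2) \in s].

Lemma card_deleted : #|deleted| <= size s.
Proof.
apply: leq_trans (leq_imset_card _ _) _.
apply: (card_le_size (f := fun p : 'I_n * 'I_n => (val p.1, val p.2))).
  by move=> [i j] [k l] _ _ [/val_inj-> /val_inj->].
by move=> p; rewrite inE.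
Qed.

Lemma adj_deleted (x y : del_edges deleted) : color x = false ->
  adj x y = [&& color y, near x.1 y.1 & (val x.1, val y.1) \notin s].
Proof.
move=> xc; rewrite /= /del_adj adj_ladder xc.
case yc: (color y) => //=; congr (_ && ~~ _).
have ->: [set x; y] = ladder_edge (x.1, y.1).
  by rewrite /ladder_edge /= -{1}xc -{1}yc !cell_color.
by rewrite mem_imset ?inE //; apply: ladder_edge_inj.
Qed.

(** One map f serves both colors: the vertex of column i keeps a neighbor in
    column f i whichever its color. *)
Lemma no_isolated_deleted (f : nat -> nat) :
    (forall i, i < n ->
      [&& f i < n, near i (f i), (i, f i) \notin s & (f i, i) \notin s]) ->
  no_isolated (del_edges deleted).
Proof.
move=> fP; apply/no_isolatedP => x.
have /and4P[fx_ltn xfx nsxf nsfx] := fP x.1 (ltn_ord _).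
exists (cell (~~ color x) (Ordinal fx_ltn)); case xc: (color x) => /=.
  rewrite [del_adj _ _ _](@adj_sym (del_edges deleted)) adj_deleted ?color_cell //.
  by rewrite xc nsfx; move: xfx; rewrite /near /=; lia.
by rewrite [del_adj _ _ _]adj_deleted // color_cell xfx.
Qed.

Lemma deleted_sub_edges : all (fun p => near p.1 p.2) s ->
  deleted \subset edges (grid n 2).
Proof.
move=> /allP near_s; apply/subsetP => _ /imsetP[[i j] + ->]; rewrite inE => /near_s ij.
rewrite inE; apply/existsP; exists (cell false i); apply/existsP; exists (cell true j).
by rewrite adj_ladder !color_cell eqxx andbT.
Qed.

(** For any n, the class of the residue of n - 1 has ceil(n/3) elements, because
    it contains the last column; the deletions can thus be confined to the left
    end of the ladder.  If, after deletion, the vertex of color [false] in column e shares no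
    neighbor with that class, it extends the class to a packing of size
    ceil(n/3) + 1.  Together with the columns 0, 3, 6, ... of color [true], this
    gives a packing of size 2 ceil(n/3) + 1. *)
Lemma total_bonding_deleted (e : nat) :
    all (fun p => near p.1 p.2) s ->
    no_isolated (del_edges deleted) ->
    e < n -> e %% 3 != n.-1 %% 3 ->
    (forall i j, i < n -> j < n -> i %% 3 = n.-1 %% 3 ->
       near e j -> (e, j) \notin s -> near i j -> (i, j) \in s) ->
  total_bonding deleted.
Proof.
move=> near_s noiso e_ltn er eP.
apply/and3P; split=> //; first exact: deleted_sub_edges.
apply: leq_ltn_trans total_domination_number_ladder_le _; set r := n.-1 %% 3 in er eP.
pose x0 : grid n 2 := cell false (Ordinal e_ltn).
have x0c : color x0 = false := color_cell _ _.
pose P : {set del_edges deleted} := x0 |: class false r.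
pose Q : {set del_edges deleted} := class true 0.
have Pc : {in P, forall x, color x = false}.
  by move=> x /setU1P[-> // | ]; rewrite inE => /andP[/eqP].
have Qc : {in Q, forall x, color x = true} by move=> x; rewrite inE => /andP[/eqP].
have x0P x y : x \in class false r -> @adj (del_edges deleted) x0 y ->
    @adj (del_edges deleted) x y -> False.
  rewrite inE => /andP[/eqP xc /eqP xr].
  rewrite !adj_deleted // => /and3P[_ ey sey] /and3P[_ xy].
  by rewrite (eP _ _ (ltn_ord _) (ltn_ord _) xr ey sey xy).
have packP : packing P.
  move=> x z y /setU1P[-> | xr] /setU1P[-> | zr] //.
  - by move=> x0y zy; case: (x0P z y).
  - by move=> xy x0y; case: (x0P x y).
  - by move=> /andP[xy _] /andP[zy _]; apply: (packing_class xr zr xy zy).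
have packQ : packing Q.
  by move=> x z y xr zr /andP[xy _] /andP[zy _]; apply: (packing_class xr zr xy zy).
have packPQ := packing_colors Pc Qc packP packQ.
apply: leq_trans (leq_packing_total_domination_number noiso packPQ).
rewrite (card_setU_colors Pc Qc) cardsU1 !card_class ?ltn_mod //.
by rewrite inE x0c /= (negPf er) /= /r; lia.
Qed.

End Ladder.

Theorem theorem3p1 (n : nat) (hn : 2 <= n) :
  [/\ n = 0 %[mod 3] -> total_bondage_number (grid n 2) = Some 1,
      n = 2 %[mod 3] -> total_bondage_number (grid n 2) = Some 2 &
      n = 1 %[mod 3] -> total_bondage_number (grid n 2) = Some 3].
Proof.
(* When the rungs of columns 0 and 1 are deleted, the rails between these two
   columns are kept. *)
pose swap i := if i is 0 then 1 else if i is 1 then 0 else i.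
split=> n_mod.
(* The class is 2, 5, ..., n - 1; column 0, left with column 0 as its only
   dominator, joins it. *)
- apply: (total_bondage_number_eq (B := deleted n [:: (0, 1)])).
  + apply: (total_bonding_deleted (e := 0)) => //; try lia.
      apply: (no_isolated_deleted (f := id)) => i i_ltn.
      rewrite /near ?inE ?xpair_eqE; lia.
    move=> i j; rewrite /near ?inE ?xpair_eqE; lia.
  + exact: card_deleted.
  + move=> B; apply: (total_bonding_ge (rs := [:: 1])) => //=.
    by rewrite /optimal_class /missed_columns /=; case: eqP => /=; lia.
(* The class is 1, 4, ..., n - 1; column 0 is left with dominator 1, which
   column 1 has lost. *)
- apply: (total_bondage_number_eq (B := deleted n [:: (0, 0); (1, 1)])).
  + apply: (total_bonding_deleted (e := 0)) => //; try lia.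
      apply: (no_isolated_deleted (f := swap)) => -[|[|i]] i_ltn;
        rewrite /near ?inE ?xpair_eqE /=; lia.
    move=> i j; rewrite /near ?inE ?xpair_eqE; lia.
  + exact: card_deleted.
  + move=> B; apply: (total_bonding_ge (rs := [:: 0; 1])) => //=.
    by rewrite /optimal_class /missed_columns /=; do 2!case: eqP => /=; lia.
(* The class is 0, 3, ..., n - 1; column 1 is left with dominator 0, which
   column 0 has lost. *)
- apply: (total_bondage_number_eq (B := deleted n [:: (0, 0); (1, 1); (1, 2)])).
  + apply: (total_bonding_deleted (e := 1)) => //; try lia.
      apply: (no_isolated_deleted (f := swap)) => -[|[|i]] i_ltn;
        rewrite /near ?inE ?xpair_eqE /=; lia.
    move=> i j; rewrite /near ?inE ?xpair_eqE; lia.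
  + exact: card_deleted.
  + move=> B; apply: (total_bonding_ge (rs := [:: 0; 1; 2])) => //=.
    by rewrite /optimal_class /missed_columns /=; do 3!case: eqP => /=; lia.
Qed.
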